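(* Let $f:I\to\mathbb{S}^2_1$ be a unit speed space-like curve. Then $$\tilde\gamma(v)=a\int_0^v f(t)\,dt+a\tanh\xi_1\int_0^v f(t)\times f'(t)\,dt$$ is a space-like Bertrand curve, where $a$ and $\xi_1=\xi_1(u)=\tanh\theta\,\ln u$ are constants and $\theta$ is a constant different from $0$. Moreover, all space-like Bertrand curves can be constructed by this method.
   Context: Minkowski 3-space $\mathbb{R}^3_1$ is $\mathbb{R}^3$ with $\langle x,y\rangle=x_1y_1+x_2y_2-x_3y_3$ and $\|x\|=\sqrt{|\langle x,x\rangle|}$. A vector $x$ is space-like if $\langle x,x\rangle>0$ or $x=0$, time-like if $\langle x,x\rangle<0$, light-like if $\langle x,x\rangle=0$ and $x\neq0$. A regular curve defined on an interval $I\subset\mathbb{R}$ is space-like (time-like) if all its velocity vectors are; it is unit speed if its velocity has pseudo-norm $1$. The Lorentzian cross product is $x\times y=(x_2y_3-x_3y_2,\;x_3y_1-x_1y_3,\;x_2y_1-x_1y_2)$, so that $\langle x\times y,z\rangle=\det(x,y,z)$. De Sitter 2-space is $\mathbb{S}^2_1=\{x\in\mathbb{R}^3_1:\langle x,x\rangle=1\}$. For a space-like curve $\alpha$ with arc-length parameter $s$, it is assumed that $T'(s)$ is space-like, where $T=\alpha'$. The Frenet frame is $T=\alpha'$, $N=\alpha''/\|\alpha''\|$, $B=N\times T$; the curvature is $\kappa=\|T'\|$ and the torsion is $\tau=-\langle N',B\rangle$. A space-like curve is a (space-like) Bertrand curve if and only if there are non-zero real constants $A,B$ such that $A\kappa(s)+B\tau(s)=1$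 for all $s$.
   Formalization: The converse is false as stated and is proved only for Bertrand curves with Aκ+Bτ=1 and |B|<|A|, up to translation and reparametrization; the first claim assumes a≠0, u>0, u≠1 (so ξ₁≠0, without which it fails) and that γ̃ has space-like non-zero T′. *)

(* Defs.v *)
(* Stdlib world: the classical reals R, with Coquelicot. *)
From Stdlib Require Import Reals.
From Coquelicot Require Import Coquelicot.
Open Scope R_scope.

(** * Minkowski 3-space *)

(* The linear structure is Coquelicot's product structure: [plus], [scal] and
   [zero] on [R * R * R]. *)
Definition R31 : Type := (R * R * R)%type.

Definition x1 (x : R31) : R := fst (fst x).
Definition x2 (x : R31) : R := snd (fst x).
Definition x3 (x : R31) : R := snd x.

Definition mdot (x y : R31) : R := x1 x * x1 y + x2 x * x2 y - x3 x * x3 y.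

Definition mnorm (x : R31) : R := sqrt (Rabs (mdot x x)).

Definition spacelike (x : R31) : Prop := 0 < mdot x x \/ x = zero.

Definition cross (x y : R31) : R31 :=
  (x2 x * x3 y - x3 x * x2 y,
   x3 x * x1 y - x1 x * x3 y,
   x2 x * x1 y - x1 x * x2 y).

Definition de_sitter (x : R31) : Prop := mdot x x = 1.

(** * Calculus of curves *)

(* Any interval with more than one point: open, half-open or closed, bounded
   or not. *)
Definition is_interval (I : R -> Prop) : Prop :=
  (forall x y z : R, I x -> I y -> x <= z <= y -> I z) /\
  (exists x y : R, I x /\ I y /\ x < y).

(* A curve on [I] is a total function of which only the values on [I] matter.
   Smoothness at an end point that belongs to [I] means that the function is
   smooth on an open neighbourhood of it, so its two-sided derivatives there
   are the one-sided derivatives of the restriction to [I]. *)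
Definition smooth_on (I : R -> Prop) (g : R -> R) : Prop :=
  forall t : R, I t ->
    locally t (fun t' : R => forall n : nat, ex_derive_n g n t').

Definition vsmooth_on (I : R -> Prop) (c : R -> R31) : Prop :=
  smooth_on I (fun t => x1 (c t)) /\
  smooth_on I (fun t => x2 (c t)) /\
  smooth_on I (fun t => x3 (c t)).

Definition vderive (c : R -> R31) (t : R) : R31 :=
  (Derive (fun t' => x1 (c t')) t,
   Derive (fun t' => x2 (c t')) t,
   Derive (fun t' => x3 (c t')) t).

Definition vint (c : R -> R31) (a b : R) : R31 :=
  (RInt (fun t => x1 (c t)) a b,
   RInt (fun t => x2 (c t)) a b,
   RInt (fun t => x3 (c t)) a b).

(** * Space-like curves *)

(* [zero] counts as space-like, so regularity is a separate condition. *)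
Definition spacelike_curve (I : R -> Prop) (c : R -> R31) : Prop :=
  vsmooth_on I c /\
  forall t : R, I t -> vderive c t <> zero /\ spacelike (vderive c t).

Definition unit_speed (I : R -> Prop) (c : R -> R31) : Prop :=
  forall t : R, I t -> mnorm (vderive c t) = 1.

(* [alpha], on [J], is the curve [gamma] on [I] referred to its arc length:
   [gamma = alpha o h] for an increasing smooth change of parameter [h] of [I]
   onto [J]. *)
Definition arc_length_param (I : R -> Prop) (gamma : R -> R31)
    (J : R -> Prop) (alpha : R -> R31) : Prop :=
  spacelike_curve J alpha /\ unit_speed J alpha /\
  exists h : R -> R,
    smooth_on I h /\
    (forall t : R, I t -> 0 < Derive h t) /\
    (forall s : R, J s <-> exists t : R, I t /\ h t = s) /\
    (forall t : R, I t -> gamma t = alpha (h t)).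

(** * Frenet apparatus of a unit speed space-like curve *)

Definition tangent (alpha : R -> R31) : R -> R31 := vderive alpha.

Definition curvature (alpha : R -> R31) (s : R) : R :=
  mnorm (vderive (tangent alpha) s).

Definition normal (alpha : R -> R31) (s : R) : R31 :=
  scal (/ mnorm (vderive (vderive alpha) s)) (vderive (vderive alpha) s).

Definition binormal (alpha : R -> R31) (s : R) : R31 :=
  cross (normal alpha s) (tangent alpha s).

Definition torsion (alpha : R -> R31) (s : R) : R :=
  - mdot (vderive (normal alpha) s) (binormal alpha s).

(* The standing assumption under which the frame is defined. The condition
   [<> zero] is needed because [zero] is space-like, while [normal] divides by
   the pseudo-norm. *)
Definition frenet_assumption (J : R -> Prop) (alpha : R -> R31) : Prop :=
  forall s : R, J s ->
    vderive (tangent alpha) s <> zero /\ spacelike (vderive (tangent alpha) s).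

(** * Bertrand curves *)

Definition bertrand_with (A B : R) (I : R -> Prop) (gamma : R -> R31) : Prop :=
  spacelike_curve I gamma /\
  exists (J : R -> Prop) (alpha : R -> R31),
    arc_length_param I gamma J alpha /\
    frenet_assumption J alpha /\
    forall s : R, J s -> A * curvature alpha s + B * torsion alpha s = 1.

Definition spacelike_bertrand (I : R -> Prop) (gamma : R -> R31) : Prop :=
  exists A B : R, A <> 0 /\ B <> 0 /\ bertrand_with A B I gamma.

(** * The construction *)

Definition xi1 (theta u : R) : R := tanh theta * ln u.

Definition gamma_tilde (a theta u : R) (f : R -> R31) (v : R) : R31 :=
  plus (scal a (vint f 0 v))
       (scal (a * tanh (xi1 theta u))
             (vint (fun t => cross (f t) (vderive f t)) 0 v)).

(* [xi1] is required to be non-zero, that is [u <> 1]: for [xi1 = 0] the curve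
   is [a] times an integral of [f], whose curvature is constant while its
   torsion is arbitrary. *)
Definition construction_data (a theta u : R) (I : R -> Prop) (f : R -> R31) : Prop :=
  a <> 0 /\ theta <> 0 /\ 0 < u /\ u <> 1 /\
  is_interval I /\ I 0 /\
  spacelike_curve I f /\ unit_speed I f /\
  (forall t : R, I t -> de_sitter (f t)).

(* [gamma] on [I] is, up to a translation and an increasing smooth change of
   parameter [phi], the curve [gamma_tilde] on [J]. *)
Definition constructed (I : R -> Prop) (gamma : R -> R31) : Prop :=
  exists (a theta u : R) (J : R -> Prop) (f : R -> R31) (phi : R -> R) (p : R31),
    construction_data a theta u J f /\
    smooth_on I phi /\
    (forall t : R, I t -> 0 < Derive phi t) /\
    (forall v : R, J v <-> exists t : R, I t /\ phi t = v) /\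
    (forall t : R, I t -> gamma t = plus p (gamma_tilde a theta u f (phi t))).

(* Main.v *)
Require Import Defs.
From Stdlib Require Import Reals Lra.
From Coquelicot Require Import Coquelicot.
Open Scope R_scope.

(** In both directions one frame does the work. Let [p], [q] be unit space-like
    fields along an interval with [p' = lam q], [lam <> 0], and put
    [g = p x q], which is orthogonal to both and has [<g, g> = -1]. Then
    [q' = - lam p - mu g] and [g' = - mu q] with [mu = <q', g>]
    ([moving_frame]).

    For a unit speed curve [f] in de Sitter space take [p = f], [q = f'],
    [lam = 1], and write [k] for [mu] and [r] for [tanh xi1]. The constructed
    curve has velocity [a (f + r g)], of constant squared length
    [c^2 = a^2 (1 - r^2)], so its arc length parameter is affine in [v]. The
    derivative of its unit tangent is a multiple of [q] by
    [a (1 - r k) / c^2]. The Frenet assumption says that this factor does not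
    vanish, so on the interval it has a constant sign [e]; hence the principal
    normal is [e q], the curvature is [e a (1 - r k) / c^2], and one finds
    the torsion [a (k - r) / c^2]. The combination of these with coefficients
    [e a] and [a r] is [a^2 (1 - r^2) / c^2 = 1].

    For a unit speed Bertrand curve take [p] the tangent, [q] the normal,
    [lam] the curvature; then [g] is minus the binormal and [mu] is the torsion.
    Solving [a (f + r (f x f')) = c p] with [f' = q] suggests
    [f = (A p - B g) / c] with [c^2 = A^2 - B^2], [a = A] and [r = B / A];
    this is where [|B| < |A|] is needed, as a value of the hyperbolic tangent
    has modulus less than 1. The derivative of [f] along the arc is [(A lam + B mu) q / c], which the
    Bertrand relation turns into [q / c]: as a function of arc length divided by
    [c], the curve [f] has unit speed and [f' = q]. Its constructed curve has
    velocity [c p], which is that of the given curve in the same parameter, so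
    the two differ by a translation.

    The intervals may contain their end points, and the relations between the
    fields hold on the interval only, while derivatives are two-sided. Hence
    relations are differentiated by [is_derive_unique_on]: two functions that
    agree on an interval have the same derivative at each of its points where
    both derivatives exist. This requires every field that occurs to be smooth
    near the interval, hence closure properties of smoothness, of which the
    delicate one is for the normal, a quotient by a pseudo-norm
    ([vsmooth_on_normal]). *)

(** * Smooth functions *)

Lemma ex_derive_n_S (g : R -> R) (n : nat) (t : R) :
  ex_derive g t -> ex_derive_n (Derive g) n t -> ex_derive_n g (S n) t.
Proof.
  intros H0 Hn. destruct n as [|n]; [exact H0|].
  simpl in *.
  apply ex_derive_ext with (2 := Hn).
  intros x. change (Derive_n (Derive_n g 1) n x = Derive_n g (S n) x).
  rewrite Derive_n_comp. now rewrite Nat.add_comm.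
Qed.

Lemma ex_derive_n_Derive (g : R -> R) (n : nat) (t : R) :
  ex_derive_n g (S n) t -> ex_derive_n (Derive g) n t.
Proof.
  intros H. destruct n as [|n]; [exact I|].
  simpl in *.
  apply ex_derive_ext with (2 := H).
  intros x. change (Derive_n g (S n) x = Derive_n (Derive_n g 1) n x).
  rewrite Derive_n_comp. now rewrite Nat.add_comm.
Qed.

(** Smoothness is a greatest fixed point: a class of functions that is closed
    under taking derivatives on an open set consists of smooth functions, by
    induction on the order of the derivative. No Leibniz formula for higher
    derivatives is ever needed. *)
Lemma smooth_on_coinduction (U : R -> Prop) (P : (R -> R) -> Prop) :
  open U ->
  (forall g, P g ->
     exists g', P g' /\ forall t, U t -> is_derive g t (g' t)) ->
  forall g, P g -> smooth_on U g.
Proof.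
  intros oU HP.
  assert (H : forall n g t, P g -> U t -> ex_derive_n g n t).
  { induction n as [|n IH]; intros g t Pg Ut; [exact I|].
    destruct (HP g Pg) as [g' [Pg' Hg']].
    apply ex_derive_n_S; [now exists (g' t); apply Hg'|].
    apply ex_derive_n_ext_loc with g'; [|now apply IH].
    apply filter_imp with (2 := oU t Ut).
    intros x Ux. symmetry. now apply is_derive_unique, Hg'. }
  intros g Pg t Ut. apply filter_imp with (2 := oU t Ut).
  intros x Ux n. now apply H.
Qed.

Lemma smooth_on_subset (I J : R -> Prop) (g : R -> R) :
  (forall t, I t -> J t) -> smooth_on J g -> smooth_on I g.
Proof. intros IJ Hg t It. now apply Hg, IJ. Qed.

Lemma smooth_on_is_derive (I : R -> Prop) (g : R -> R) (t : R) :
  smooth_on I g -> I t -> is_derive g t (Derive g t).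
Proof.
  intros Hg It. apply Derive_correct.
  exact (locally_singleton _ _ (Hg t It) 1%nat).
Qed.

Lemma smooth_on_continuous (I : R -> Prop) (g : R -> R) (t : R) :
  smooth_on I g -> I t -> continuous g t.
Proof.
  intros Hg It. apply (ex_derive_continuous (V := R_NormedModule)).
  eexists. now apply (smooth_on_is_derive I).
Qed.

Lemma smooth_on_Derive (I : R -> Prop) (g : R -> R) :
  smooth_on I g -> smooth_on I (Derive g).
Proof.
  intros Hg t It. apply filter_imp with (2 := Hg t It).
  intros x Hx n. now apply ex_derive_n_Derive.
Qed.

Lemma smooth_on_antiderivative (I : R -> Prop) (G g : R -> R) :
  smooth_on I g ->
  (forall t, I t -> locally t (fun x => is_derive G x (g x))) ->
  smooth_on I G.
Proof.
  intros Hg HG t It.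
  generalize (filter_and _ _ (locally_locally _ _ (HG t It)) (Hg t It)).
  apply filter_imp. intros x [Gx gx] [|n]; [exact Logic.I|].
  apply ex_derive_n_S.
  - exists (g x). exact (locally_singleton _ _ Gx).
  - apply ex_derive_n_ext_loc with g; [|apply gx].
    apply filter_imp with (2 := Gx).
    intros y Hy. symmetry. now apply is_derive_unique.
Qed.

Lemma smooth_on_const (I : R -> Prop) (k : R) : smooth_on I (fun _ => k).
Proof.
  intros t _. apply filter_forall. intros x n. apply ex_derive_n_const.
Qed.

Lemma smooth_on_comp_affine (I J : R -> Prop) (g : R -> R) (p q : R) :
  smooth_on J g -> (forall t, I t -> J (p * t + q)) ->
  smooth_on I (fun t => g (p * t + q)).
Proof.
  intros Hg IJ t It.
  assert (Hc : filterlim (fun x => p * x + q) (locally t) (locally (p * t + q))).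
  { apply (ex_derive_continuous (V := R_NormedModule) (fun x : R => p * x + q)).
    auto_derive. exact Logic.I. }
  pose proof (Hc _ (locally_locally _ _ (Hg _ (IJ t It)))) as H.
  unfold filtermap in H. revert H. apply filter_imp. intros x Hx n.
  apply (ex_derive_n_comp_scal (fun y => g (y + q))).
  assert (Hq : filterlim (fun y => y + q) (locally (p * x)) (locally (p * x + q))).
  { apply (ex_derive_continuous (V := R_NormedModule) (fun y : R => y + q)).
    auto_derive. exact Logic.I. }
  pose proof (Hq _ Hx) as H. unfold filtermap in H. revert H.
  apply filter_imp. intros y Hy k _.
  apply ex_derive_n_comp_trans, Hy.
Qed.

(** The reciprocal of the pseudo-norm of a vector [x] is this function at
    [mdot x x]. *)
Definition rsqrt_abs (y : R) : R := / sqrt (Rabs y).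

(** The derivative is polynomial in the function itself and [dq], so adjoining
    [rsqrt_abs (q x)] to an algebra of functions keeps it closed under
    derivation. *)
Lemma is_derive_rsqrt_abs (q : R -> R) (t dq : R) :
  is_derive q t dq -> 0 < q t ->
  is_derive (fun x => rsqrt_abs (q x)) t
    (- / 2 * dq * (rsqrt_abs (q t) * (rsqrt_abs (q t) * rsqrt_abs (q t)))).
Proof.
  intros Hq Pq.
  assert (Hs : 0 < sqrt (q t)) by now apply sqrt_lt_R0.
  apply is_derive_ext_loc with (fun x => / sqrt (q x)).
  - assert (Cq : filterlim q (locally t) (locally (q t))).
    { apply (ex_derive_continuous (V := R_NormedModule)). now exists dq. }
    pose proof (Cq _ (open_gt 0 _ Pq)) as H. unfold filtermap in H. revert H.
    apply filter_imp. intros x Hx. unfold rsqrt_abs. rewrite Rabs_right; [easy|lra].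
  - evar_last.
    + apply is_derive_inv; [|lra].
      apply is_derive_sqrt; [exact Hq|exact Pq].
    + unfold rsqrt_abs. rewrite (Rabs_right (q t)) by lra. field. lra.
Qed.

(** The closure of the smooth functions under the operations that are to be
    shown smooth. It is closed under derivation, which the products of two
    smooth functions alone are not, so [smooth_on_coinduction] applies. *)
Inductive smooth_algebra (U : R -> Prop) : (R -> R) -> Prop :=
| sa_smooth g : smooth_on U g -> smooth_algebra U g
| sa_rsqrt q : smooth_on U q -> (forall t, U t -> 0 < q t) ->
    smooth_algebra U (fun t => rsqrt_abs (q t))
| sa_plus g h : smooth_algebra U g -> smooth_algebra U h ->
    smooth_algebra U (fun t => g t + h t)
| sa_mult g h : smooth_algebra U g -> smooth_algebra U h ->
    smooth_algebra U (fun t => g t * h t).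

Lemma smooth_algebra_smooth (U : R -> Prop) (g : R -> R) :
  open U -> smooth_algebra U g -> smooth_on U g.
Proof.
  intros oU. revert g. apply smooth_on_coinduction; [exact oU|].
  intros g Hg. induction Hg as [g Hg|q Hq Pq|g h Hg [g' [Ag Dg]] Hh [h' [Ah Dh]]
    |g h Hg [g' [Ag Dg]] Hh [h' [Ah Dh]]].
  - exists (Derive g). split; [now apply sa_smooth, smooth_on_Derive|].
    intros t Ut. now apply (smooth_on_is_derive U).
  - exists (fun t => - / 2 * Derive q t *
      (rsqrt_abs (q t) * (rsqrt_abs (q t) * rsqrt_abs (q t)))). split.
    + pose proof (sa_rsqrt U q Hq Pq) as Hr.
      apply sa_mult; [|now repeat apply sa_mult].
      apply sa_mult; apply sa_smooth; [apply smooth_on_const|].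
      now apply smooth_on_Derive.
    + intros t Ut. apply is_derive_rsqrt_abs; [|now apply Pq].
      now apply (smooth_on_is_derive U).
  - exists (fun t => g' t + h' t). split; [now apply sa_plus|].
    intros t Ut. apply (is_derive_plus (K := R_AbsRing) (V := R_NormedModule));
      [now apply Dg|now apply Dh].
  - exists (fun t => g' t * h t + g t * h' t). split.
    + now apply sa_plus; apply sa_mult.
    + intros t Ut. apply (is_derive_mult (K := R_AbsRing));
      [now apply Dg|now apply Dh|exact Rmult_comm].
Qed.

(** Smoothness on a set that is not open holds on the open set of all points of
    smoothness, where the coinduction principle is available. *)
Definition smooth_points (g : R -> R) (t : R) : Prop :=
  locally t (fun x => forall n : nat, ex_derive_n g n x).

Lemma open_smooth_points (g : R -> R) : open (smooth_points g).
Proof. intros t Ht. now apply locally_locally. Qed.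

Lemma smooth_on_plus (I : R -> Prop) (g h : R -> R) :
  smooth_on I g -> smooth_on I h -> smooth_on I (fun t => g t + h t).
Proof.
  intros Hg Hh.
  apply smooth_on_subset with (fun t => smooth_points g t /\ smooth_points h t).
  - intros t It. split; [exact (Hg t It)|exact (Hh t It)].
  - apply smooth_algebra_smooth;
      [apply open_and; apply open_smooth_points|].
    apply sa_plus; apply sa_smooth; now intros t [].
Qed.

Lemma smooth_on_mult (I : R -> Prop) (g h : R -> R) :
  smooth_on I g -> smooth_on I h -> smooth_on I (fun t => g t * h t).
Proof.
  intros Hg Hh.
  apply smooth_on_subset with (fun t => smooth_points g t /\ smooth_points h t).
  - intros t It. split; [exact (Hg t It)|exact (Hh t It)].
  - apply smooth_algebra_smooth;
      [apply open_and; apply open_smooth_points|].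
    apply sa_mult; apply sa_smooth; now intros t [].
Qed.

Lemma smooth_on_minus (I : R -> Prop) (g h : R -> R) :
  smooth_on I g -> smooth_on I h -> smooth_on I (fun t => g t - h t).
Proof.
  intros Hg Hh.
  apply smooth_on_plus; [exact Hg|].
  intros t It. apply filter_imp with (2 := Hh t It).
  intros x Hx n. now apply ex_derive_n_opp.
Qed.

Lemma smooth_on_rsqrt_abs (I : R -> Prop) (q : R -> R) :
  smooth_on I q -> (forall t, I t -> 0 < q t) ->
  smooth_on I (fun t => rsqrt_abs (q t)).
Proof.
  intros Hq Pq.
  apply smooth_on_subset with (fun t => smooth_points q t /\ 0 < q t).
  - intros t It. split; [exact (Hq t It)|now apply Pq].
  - apply smooth_algebra_smooth.
    + intros t [Ht Pt]. apply filter_and; [now apply open_smooth_points|].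
      exact (smooth_on_continuous (smooth_points q) q t (fun _ H => H) Ht _
               (open_gt 0 _ Pt)).
    + apply sa_rsqrt; now intros t [].
Qed.

(** At an end point of [I] the formula must hold on both sides; it does, since
    [g] is continuous somewhat beyond the end point, so that the integral can be
    extended there. *)
Lemma locally_is_derive_RInt (I : R -> Prop) (g : R -> R) (t0 t : R) :
  is_interval I -> I t0 -> I t -> smooth_on I g ->
  locally t (fun x => is_derive (fun v => RInt g t0 v) x (g x)).
Proof.
  intros [HI _] It0 It Hg.
  assert (Ht : ex_RInt g t0 t).
  { apply (ex_RInt_continuous (V := R_CompleteNormedModule)).
    intros z Hz. apply (smooth_on_continuous I); [exact Hg|].
    revert Hz. unfold Rmin, Rmax. destruct (Rle_dec t0 t); intros Hz;
      [apply (HI t0 t)|apply (HI t t0)]; auto. }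
  assert (Hx : locally t (fun x => ex_RInt g t0 x)).
  { destruct (Hg t It) as [eps He]. exists eps. intros x Hx.
    apply ex_RInt_Chasles with t; [exact Ht|].
    apply (ex_RInt_continuous (V := R_CompleteNormedModule)).
    intros z Hz. apply (ex_derive_continuous (V := R_NormedModule)).
    refine (He z _ 1%nat).
    revert Hx Hz. unfold ball; simpl; unfold AbsRing_ball, abs, minus, plus, opp; simpl.
    unfold Rmin, Rmax. destruct (Rle_dec t x); unfold Rabs;
    repeat destruct Rcase_abs; lra. }
  generalize (filter_and _ _ (locally_locally _ _ Hx) (Hg t It)).
  apply filter_imp. intros x [Ix Sx].
  apply is_derive_RInt with t0.
  - apply filter_imp with (2 := Ix). intros y Hy.
    now apply (RInt_correct (V := R_CompleteNormedModule)).
  - apply (ex_derive_continuous (V := R_NormedModule)). exact (Sx 1%nat).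
Qed.

(** * Functions on an interval *)

Lemma smooth_on_continuity_pt (I : R -> Prop) (g : R -> R) (t : R) :
  smooth_on I g -> I t -> continuity_pt g t.
Proof.
  intros Hg It. apply continuity_pt_filterlim.
  now apply (smooth_on_continuous I).
Qed.

(** A non-degenerate interval contains points arbitrarily close to [t] on at
    least one side, and difference quotients on that side determine the
    derivative. *)
Lemma is_derive_of_zero_on (I : R -> Prop) (g : R -> R) (t l : R) :
  is_interval I -> I t -> (forall x, I x -> g x = 0) ->
  is_derive g t l -> l = 0.
Proof.
  intros [HI [a [b [Ia [Ib ab]]]]] It Hg Hl.
  apply is_derive_Reals in Hl.
  destruct (Req_dec l 0) as [E|N]; [exact E|exfalso].
  destruct (Hl (Rabs l) (Rabs_pos_lt l N)) as [d Hd].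
  assert (Hh : exists h, h <> 0 /\ Rabs h < d /\ I (t + h)).
  { pose proof (cond_pos d) as Pd.
    destruct (Rlt_dec t b) as [L|L].
    - exists (Rmin (d / 2) (b - t)).
      pose proof (Rmin_l (d / 2) (b - t)). pose proof (Rmin_r (d / 2) (b - t)).
      assert (0 < Rmin (d / 2) (b - t)) by (apply Rmin_pos; lra).
      repeat split; [lra| rewrite Rabs_right; lra|].
      apply (HI t b); [exact It|exact Ib|lra].
    - exists (- Rmin (d / 2) (t - a)).
      pose proof (Rmin_l (d / 2) (t - a)). pose proof (Rmin_r (d / 2) (t - a)).
      assert (0 < Rmin (d / 2) (t - a)) by (apply Rmin_pos; lra).
      repeat split; [lra| rewrite Rabs_Ropp, Rabs_right; lra|].
      apply (HI a t); [exact Ia|exact It|lra]. }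
  destruct Hh as [h [h0 [hd Ih]]].
  specialize (Hd h h0 hd).
  rewrite (Hg _ Ih), (Hg _ It) in Hd.
  replace ((0 - 0) / h - l) with (- l) in Hd by (field; exact h0).
  rewrite Rabs_Ropp in Hd. lra.
Qed.

Lemma is_derive_unique_on (I : R -> Prop) (g h : R -> R) (t l m : R) :
  is_interval I -> I t -> (forall x, I x -> g x = h x) ->
  is_derive g t l -> is_derive h t m -> l = m.
Proof.
  intros HI It E Hl Hm.
  apply Rminus_diag_uniq.
  apply (is_derive_of_zero_on I (fun x => g x - h x) t); [easy|easy| |].
  - intros x Ix. rewrite (E x Ix). ring.
  - now apply (is_derive_minus (K := R_AbsRing) (V := R_NormedModule)).
Qed.

Lemma eq_on_of_is_derive (I : R -> Prop) (g h d : R -> R) (t0 : R) :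
  is_interval I -> I t0 -> g t0 = h t0 ->
  (forall t, I t -> is_derive g t (d t)) ->
  (forall t, I t -> is_derive h t (d t)) ->
  forall t, I t -> g t = h t.
Proof.
  intros [HI _] It0 E Hg Hh t It.
  assert (H0 : forall x, I x -> is_derive (fun x => g x - h x) x zero).
  { intros x Ix. evar_last.
    - apply (is_derive_minus (K := R_AbsRing) (V := R_NormedModule));
        [now apply Hg|now apply Hh].
    - unfold minus, plus, opp, zero; simpl. ring. }
  assert (H : (fun x => g x - h x) t = (fun x => g x - h x) t0).
  { destruct (Rtotal_order t t0) as [L|[->|L]]; [|easy|].
    - apply (eq_is_derive (fun x => g x - h x) t t0); [|exact L].
      intros x Hx. apply H0. now apply (HI t t0).
    - symmetry. apply (eq_is_derive (fun x => g x - h x) t0 t); [|exact L].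
      intros x Hx. apply H0. now apply (HI t0 t). }
  simpl in H. lra.
Qed.

Lemma constant_sign_on (I : R -> Prop) (g : R -> R) :
  is_interval I -> (forall t, I t -> continuity_pt g t) ->
  (forall t, I t -> g t <> 0) ->
  exists e, (e = 1 \/ e = -1) /\ forall t, I t -> 0 < e * g t.
Proof.
  intros [HI [a [_ [Ia _]]]] Cg Ng.
  assert (H : forall x y, I x -> I y -> 0 < g x * g y).
  { assert (W : forall x y, I x -> I y -> x < y -> 0 < g x * g y).
    { intros x y Ix Iy xy. destruct (Rlt_dec 0 (g x * g y)) as [L|L]; [exact L|].
      exfalso. pose proof (Ng x Ix). pose proof (Ng y Iy).
      assert (C : forall k, k <> 0 -> k * g x < 0 -> 0 < k * g y -> False).
      { intros k Hk k1 k2.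
        destruct (Ranalysis5.IVT_interv (fun z => k * g z) x y) as [z [Hz Ez]];
          [|easy|easy|easy|].
        - intros z Hz.
          apply (continuity_pt_mult (fun _ => k) g z);
            [now apply continuity_pt_const|].
          apply Cg. now apply (HI x y).
        - apply (Ng z); [now apply (HI x y)|].
          destruct (Rmult_integral _ _ Ez); [contradiction|easy]. }
      destruct (Rtotal_order (g x) 0) as [L1|[E|L1]]; [|contradiction|].
      - apply (C 1); [lra|lra|]. nra.
      - apply (C (-1)); [lra|lra|]. nra. }
    intros x y Ix Iy. destruct (Rtotal_order x y) as [L|[->|L]].
    - now apply W.
    - pose proof (Ng y Iy). nra.
    - rewrite Rmult_comm. now apply W. }
  pose proof (Ng a Ia) as Na.
  destruct (Rlt_dec 0 (g a)) as [L|L].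
  - exists 1. split; [now left|]. intros t It. pose proof (H a t Ia It). nra.
  - exists (-1). split; [now right|]. intros t It. pose proof (H a t Ia It). nra.
Qed.

Lemma is_interval_image (I J : R -> Prop) (h : R -> R) :
  is_interval I -> smooth_on I h -> (forall t, I t -> 0 < Derive h t) ->
  (forall s, J s <-> exists t, I t /\ h t = s) -> is_interval J.
Proof.
  intros [HI [a [b [Ia [Ib ab]]]]] Sh Ph EJ.
  assert (Hh : forall x y, I x -> I y -> x < y -> h x < h y).
  { intros x y Ix Iy xy.
    destruct (MVT_cor2 h (Derive h) x y xy) as [c [Ec Hc]].
    - intros c Hc. apply is_derive_Reals, (smooth_on_is_derive I); [easy|].
      now apply (HI x y).
    - assert (0 < Derive h c) by (apply Ph, (HI x y); [easy|easy|lra]).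
      assert (0 < Derive h c * (y - x)) by (apply Rmult_lt_0_compat; lra).
      lra. }
  split.
  - intros r s w Jr Js Hw.
    apply EJ in Jr, Js. destruct Jr as [x [Ix Ex]], Js as [y [Iy Ey]]. subst r s.
    apply EJ.
    destruct (proj1 Hw) as [L1|L1]; [|now exists x].
    destruct (proj2 Hw) as [L2|L2]; [|now exists y].
    assert (xy : x < y).
    { destruct (Rtotal_order x y) as [L|[->|L]]; [exact L|lra|].
      pose proof (Hh y x Iy Ix L). lra. }
    destruct (Ranalysis5.IVT_interv (fun z => h z - w) x y) as [z [Hz Ez]];
      [|easy|lra|lra|].
    + intros z Hz. apply (continuity_pt_minus h (fun _ => w) z);
        [|now apply continuity_pt_const].
      apply (smooth_on_continuity_pt I); [easy|now apply (HI x y)].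
    + exists z. split; [now apply (HI x y)|lra].
  - exists (h a), (h b). repeat split.
    + apply EJ. now exists a.
    + apply EJ. now exists b.
    + now apply Hh.
Qed.

(** * Lorentzian linear algebra *)

Ltac vec_coords :=
  repeat match goal with
  | v : R31 |- _ => let a := fresh v in let b := fresh v in let c := fresh v in
      destruct v as [[a b] c]
  end;
  unfold mdot, cross, x1, x2, x3, plus, scal, opp, zero in *;
  cbn in *; unfold mult in *; cbn in *.

Lemma R31_ext (v w : R31) :
  x1 v = x1 w -> x2 v = x2 w -> x3 v = x3 w -> v = w.
Proof.
  destruct v as [[v1 v2] v3], w as [[w1 w2] w3]. unfold x1, x2, x3; simpl.
  now intros -> -> ->.
Qed.

Ltac vec_ring := apply R31_ext; vec_coords; ring.

Lemma mdot_comm (v w : R31) : mdot v w = mdot w v.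
Proof. vec_coords; ring. Qed.

Lemma mdot_plus_l (u v w : R31) : mdot (plus u v) w = mdot u w + mdot v w.
Proof. vec_coords; ring. Qed.

Lemma mdot_plus_r (u v w : R31) : mdot u (plus v w) = mdot u v + mdot u w.
Proof. vec_coords; ring. Qed.

Lemma mdot_scal_l (k : R) (v w : R31) : mdot (scal k v) w = k * mdot v w.
Proof. vec_coords; ring. Qed.

Lemma mdot_scal_r (k : R) (v w : R31) : mdot v (scal k w) = k * mdot v w.
Proof. vec_coords; ring. Qed.

Lemma mdot_cross_l (v w : R31) : mdot v (cross v w) = 0.
Proof. vec_coords; ring. Qed.

Lemma mdot_cross_cross (v w : R31) :
  mdot (cross v w) (cross v w) = mdot v w * mdot v w - mdot v v * mdot w w.
Proof. vec_coords; ring. Qed.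

Lemma cross_cross (u v w : R31) :
  cross u (cross v w)
  = plus (scal (mdot u v) w) (scal (- mdot u w) v).
Proof. vec_ring. Qed.

Lemma cross_anticomm (v w : R31) : cross v w = scal (-1) (cross w v).
Proof. vec_ring. Qed.

Lemma cross_plus_r (u v w : R31) :
  cross u (plus v w) = plus (cross u v) (cross u w).
Proof. vec_ring. Qed.

Lemma cross_scal_l (k : R) (v w : R31) : cross (scal k v) w = scal k (cross v w).
Proof. vec_ring. Qed.

Lemma cross_scal_r (k : R) (v w : R31) : cross v (scal k w) = scal k (cross v w).
Proof. vec_ring. Qed.

(** Cramer's rule for the expansion of [w] in the basis [p], [q], [cross p q],
    whose determinant is [mdot (cross p q) (cross p q)]. *)
Lemma mdot_cramer (p q w : R31) :
  scal (mdot (cross p q) (cross p q)) w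
  = plus (plus (scal (mdot w (cross q (cross p q))) p)
               (scal (- mdot w (cross p (cross p q))) q))
         (scal (mdot w (cross p q)) (cross p q)).
Proof. vec_ring. Qed.

(** The last coefficient carries a minus sign because [cross p q] is time-like:
    [mdot (cross p q) (cross p q) = -1]. *)
Lemma frame_expansion (p q w : R31) :
  mdot p p = 1 -> mdot q q = 1 -> mdot p q = 0 ->
  w = plus (plus (scal (mdot w p) p) (scal (mdot w q) q))
           (scal (- mdot w (cross p q)) (cross p q)).
Proof.
  intros pp qq pq.
  pose proof (mdot_cramer p q w) as H.
  rewrite mdot_cross_cross, !cross_cross, !mdot_plus_r, !mdot_scal_r in H.
  rewrite pp, qq, (mdot_comm q p), pq in H.
  remember (cross p q) as g.
  remember (mdot w p) as wp. remember (mdot w q) as wq. remember (mdot w g) as wg.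
  clear - H.
  apply (f_equal (fun v => scal (-1) v)) in H.
  transitivity (scal (-1) (scal (0 * 0 - 1 * 1) w)); [vec_ring|].
  rewrite H. vec_ring.
Qed.

Lemma mnorm_scal_unit (k : R) (v : R31) :
  mdot v v = 1 -> mnorm (scal k v) = Rabs k.
Proof.
  intros H. unfold mnorm. rewrite mdot_scal_l, mdot_scal_r, H, Rmult_1_r.
  rewrite Rabs_right by nra. apply sqrt_Rsqr_abs.
Qed.

Lemma mdot_of_mnorm (v : R31) : spacelike v -> mnorm v = 1 -> mdot v v = 1.
Proof.
  unfold mnorm. intros [H| ->] E.
  - rewrite Rabs_right in E by lra. rewrite <- (sqrt_sqrt (mdot v v)) by lra.
    rewrite E. ring.
  - exfalso. replace (mdot zero zero) with 0 in E by (vec_coords; ring).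
    rewrite Rabs_R0, sqrt_0 in E. lra.
Qed.

Lemma mnorm_of_mdot (v : R31) : mdot v v = 1 -> mnorm v = 1.
Proof. intros H. unfold mnorm. now rewrite H, Rabs_R1, sqrt_1. Qed.

Lemma spacelike_of_mdot_pos (v : R31) :
  0 < mdot v v -> v <> zero /\ spacelike v.
Proof.
  intros H. split; [|now left].
  intros ->. vec_coords. lra.
Qed.

Lemma mdot_tangent_binormal (p q : R31) (a b : R) :
  mdot p p = 1 -> mdot q q = 1 -> mdot p q = 0 ->
  mdot (plus (scal a p) (scal b (cross p q)))
       (plus (scal a p) (scal b (cross p q))) = a * a - b * b.
Proof.
  intros pp qq pq.
  rewrite !mdot_plus_l, !mdot_plus_r, !mdot_scal_l, !mdot_scal_r,
    mdot_cross_cross, (mdot_comm (cross p q) p), mdot_cross_l, pp, qq, pq.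
  ring.
Qed.

Lemma mdot_cross_tangent_binormal (p q w : R31) (a b : R) :
  mdot p q = 0 -> mdot q q = 1 ->
  mdot w (cross q (plus (scal a p) (scal b (cross p q))))
  = - (a * mdot w (cross p q) + b * mdot w p).
Proof.
  intros pq qq.
  rewrite cross_plus_r, !cross_scal_r, cross_cross, (mdot_comm q p), pq, qq,
    (cross_anticomm q p), !mdot_plus_r, !mdot_scal_r, mdot_plus_r, !mdot_scal_r.
  ring.
Qed.

Lemma cross_tangent_binormal (p q : R31) (a b : R) :
  mdot p q = 0 -> mdot q q = 1 ->
  cross (plus (scal a p) (scal b (cross p q))) q
  = plus (scal b p) (scal a (cross p q)).
Proof.
  intros pq qq.
  rewrite (cross_anticomm _ q), cross_plus_r, !cross_scal_r, cross_cross, qq,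
    (mdot_comm q p), pq, (cross_anticomm q p).
  generalize (cross p q). intros w. vec_ring.
Qed.

(** * Derivatives of curves *)

Definition is_vderive (c : R -> R31) (t : R) (w : R31) : Prop :=
  is_derive (fun x => x1 (c x)) t (x1 w) /\
  is_derive (fun x => x2 (c x)) t (x2 w) /\
  is_derive (fun x => x3 (c x)) t (x3 w).

Lemma is_vderive_eq (c : R -> R31) (t : R) (v w : R31) :
  is_vderive c t v -> v = w -> is_vderive c t w.
Proof. now intros H <-. Qed.

Lemma vsmooth_is_vderive (I : R -> Prop) (c : R -> R31) (t : R) :
  vsmooth_on I c -> I t -> is_vderive c t (vderive c t).
Proof.
  intros [H1 [H2 H3]] It.
  split; [|split]; now apply (smooth_on_is_derive I).
Qed.

Lemma is_vderive_unique (c : R -> R31) (t : R) (w : R31) :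
  is_vderive c t w -> vderive c t = w.
Proof.
  intros [H1 [H2 H3]].
  apply R31_ext; now apply is_derive_unique.
Qed.

(** The curves may differ off [I], so at an end point their difference need not
    vanish in a neighbourhood. *)
Lemma is_vderive_unique_on (I : R -> Prop) (c d : R -> R31) (t : R) (v w : R31) :
  is_interval I -> I t -> (forall x, I x -> c x = d x) ->
  is_vderive c t v -> is_vderive d t w -> v = w.
Proof.
  intros HI It E [C1 [C2 C3]] [D1 [D2 D3]].
  apply R31_ext.
  - apply (is_derive_unique_on I (fun x => x1 (c x)) (fun x => x1 (d x)) t);
      try easy. intros x Ix. now rewrite E.
  - apply (is_derive_unique_on I (fun x => x2 (c x)) (fun x => x2 (d x)) t);
      try easy. intros x Ix. now rewrite E.
  - apply (is_derive_unique_on I (fun x => x3 (c x)) (fun x => x3 (d x)) t);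
      try easy. intros x Ix. now rewrite E.
Qed.

(** Computes the derivative of a smooth curve from an expression for it that is
    valid on the interval only. *)
Lemma vderive_eq_on (I : R -> Prop) (c d : R -> R31) (t : R) (w : R31) :
  is_interval I -> vsmooth_on I c -> I t -> (forall x, I x -> c x = d x) ->
  is_vderive d t w -> vderive c t = w.
Proof.
  intros HI Sc It E Dw.
  apply (is_vderive_unique_on I c d t); try easy.
  now apply (vsmooth_is_vderive I).
Qed.

Lemma eq_on_of_is_vderive (I : R -> Prop) (c d w : R -> R31) (t0 : R) :
  is_interval I -> I t0 -> c t0 = d t0 ->
  (forall t, I t -> is_vderive c t (w t)) ->
  (forall t, I t -> is_vderive d t (w t)) ->
  forall t, I t -> c t = d t.
Proof.
  intros HI It0 E Hc Hd t It.
  apply R31_ext.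
  - apply (eq_on_of_is_derive I (fun x => x1 (c x)) (fun x => x1 (d x))
      (fun x => x1 (w x)) t0); try easy; [now rewrite E| |];
      intros x Ix; [now apply Hc|now apply Hd].
  - apply (eq_on_of_is_derive I (fun x => x2 (c x)) (fun x => x2 (d x))
      (fun x => x2 (w x)) t0); try easy; [now rewrite E| |];
      intros x Ix; [now apply Hc|now apply Hd].
  - apply (eq_on_of_is_derive I (fun x => x3 (c x)) (fun x => x3 (d x))
      (fun x => x3 (w x)) t0); try easy; [now rewrite E| |];
      intros x Ix; [now apply Hc|now apply Hd].
Qed.

Lemma is_derive_Rplus (g h : R -> R) (t dg dh : R) :
  is_derive g t dg -> is_derive h t dh ->
  is_derive (fun x => g x + h x) t (dg + dh).
Proof. apply (is_derive_plus (K := R_AbsRing) (V := R_NormedModule)). Qed.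

Lemma is_derive_Rminus (g h : R -> R) (t dg dh : R) :
  is_derive g t dg -> is_derive h t dh ->
  is_derive (fun x => g x - h x) t (dg - dh).
Proof. apply (is_derive_minus (K := R_AbsRing) (V := R_NormedModule)). Qed.

Lemma is_derive_Rmult (g h : R -> R) (t dg dh : R) :
  is_derive g t dg -> is_derive h t dh ->
  is_derive (fun x => g x * h x) t (dg * h t + g t * dh).
Proof.
  intros Hg Hh. apply (is_derive_mult (K := R_AbsRing)); try easy.
  exact Rmult_comm.
Qed.

Lemma is_vderive_const (v : R31) (t : R) : is_vderive (fun _ => v) t zero.
Proof.
  split; [|split]; apply (is_derive_const (K := R_AbsRing) (V := R_NormedModule)).
Qed.

Lemma is_vderive_plus (c d : R -> R31) (t : R) (v w : R31) :
  is_vderive c t v -> is_vderive d t w ->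
  is_vderive (fun x => plus (c x) (d x)) t (plus v w).
Proof.
  intros [C1 [C2 C3]] [D1 [D2 D3]].
  split; [|split]; now apply is_derive_Rplus.
Qed.

Lemma is_vderive_scal (k : R) (c : R -> R31) (t : R) (v : R31) :
  is_vderive c t v -> is_vderive (fun x => scal k (c x)) t (scal k v).
Proof.
  intros [C1 [C2 C3]].
  split; [|split]; now apply is_derive_scal.
Qed.

Lemma is_vderive_comp_affine (p q : R) (c : R -> R31) (t : R) (v : R31) :
  is_vderive c (p * t + q) v ->
  is_vderive (fun x => c (p * x + q)) t (scal p v).
Proof.
  assert (Ha : is_derive (fun x => p * x + q) t p) by (auto_derive; [easy|ring]).
  intros [C1 [C2 C3]].
  split; [|split].
  - exact (is_derive_comp (fun x => x1 (c x)) _ t _ _ C1 Ha).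
  - exact (is_derive_comp (fun x => x2 (c x)) _ t _ _ C2 Ha).
  - exact (is_derive_comp (fun x => x3 (c x)) _ t _ _ C3 Ha).
Qed.

Lemma is_derive_mdot (c d : R -> R31) (t : R) (v w : R31) :
  is_vderive c t v -> is_vderive d t w ->
  is_derive (fun x => mdot (c x) (d x)) t (mdot v (d t) + mdot (c t) w).
Proof.
  intros [C1 [C2 C3]] [D1 [D2 D3]]. unfold mdot. evar_last.
  - apply is_derive_Rminus; [apply is_derive_Rplus|]; apply is_derive_Rmult;
      eassumption.
  - cbv beta. ring.
Qed.

Lemma is_vderive_cross (c d : R -> R31) (t : R) (v w : R31) :
  is_vderive c t v -> is_vderive d t w ->
  is_vderive (fun x => cross (c x) (d x)) t
    (plus (cross v (d t)) (cross (c t) w)).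
Proof.
  intros [C1 [C2 C3]] [D1 [D2 D3]].
  split; [|split]; unfold cross, x1, x2, x3 in *; simpl in *;
    (evar_last;
     [apply is_derive_Rminus; apply is_derive_Rmult; eassumption
     |cbv beta; unfold plus; simpl; unfold plus; simpl; ring]).
Qed.

Lemma vsmooth_on_plus (I : R -> Prop) (c d : R -> R31) :
  vsmooth_on I c -> vsmooth_on I d -> vsmooth_on I (fun x => plus (c x) (d x)).
Proof.
  intros [C1 [C2 C3]] [D1 [D2 D3]].
  split; [|split]; now apply smooth_on_plus.
Qed.

Lemma vsmooth_on_scal (I : R -> Prop) (k : R -> R) (c : R -> R31) :
  smooth_on I k -> vsmooth_on I c -> vsmooth_on I (fun x => scal (k x) (c x)).
Proof.
  intros Sk [C1 [C2 C3]].
  split; [|split]; now apply smooth_on_mult.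
Qed.

Lemma smooth_on_mdot (I : R -> Prop) (c d : R -> R31) :
  vsmooth_on I c -> vsmooth_on I d -> smooth_on I (fun x => mdot (c x) (d x)).
Proof.
  intros [C1 [C2 C3]] [D1 [D2 D3]].
  apply smooth_on_minus; [apply smooth_on_plus|]; now apply smooth_on_mult.
Qed.

Lemma vsmooth_on_cross (I : R -> Prop) (c d : R -> R31) :
  vsmooth_on I c -> vsmooth_on I d -> vsmooth_on I (fun x => cross (c x) (d x)).
Proof.
  intros [C1 [C2 C3]] [D1 [D2 D3]].
  split; [|split]; apply smooth_on_minus; now apply smooth_on_mult.
Qed.

Lemma vsmooth_on_vderive (I : R -> Prop) (c : R -> R31) :
  vsmooth_on I c -> vsmooth_on I (vderive c).
Proof.
  intros [C1 [C2 C3]].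
  split; [|split]; now apply smooth_on_Derive.
Qed.

Lemma vsmooth_on_comp_affine (I J : R -> Prop) (c : R -> R31) (p q : R) :
  vsmooth_on J c -> (forall t, I t -> J (p * t + q)) ->
  vsmooth_on I (fun t => c (p * t + q)).
Proof.
  intros [C1 [C2 C3]] IJ. split; [|split].
  - exact (smooth_on_comp_affine I J (fun x => x1 (c x)) p q C1 IJ).
  - exact (smooth_on_comp_affine I J (fun x => x2 (c x)) p q C2 IJ).
  - exact (smooth_on_comp_affine I J (fun x => x3 (c x)) p q C3 IJ).
Qed.

Lemma vsmooth_on_vint (I : R -> Prop) (c : R -> R31) (t0 : R) :
  is_interval I -> I t0 -> vsmooth_on I c -> vsmooth_on I (vint c t0).
Proof.
  intros HI It0 [C1 [C2 C3]]. split; [|split].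
  - apply (smooth_on_antiderivative I _ (fun x => x1 (c x))); [easy|].
    intros t It. now apply (locally_is_derive_RInt I).
  - apply (smooth_on_antiderivative I _ (fun x => x2 (c x))); [easy|].
    intros t It. now apply (locally_is_derive_RInt I).
  - apply (smooth_on_antiderivative I _ (fun x => x3 (c x))); [easy|].
    intros t It. now apply (locally_is_derive_RInt I).
Qed.

Lemma is_vderive_vint (I : R -> Prop) (c : R -> R31) (t0 t : R) :
  is_interval I -> I t0 -> I t -> vsmooth_on I c ->
  is_vderive (vint c t0) t (c t).
Proof.
  intros HI It0 It [C1 [C2 C3]].
  assert (H : forall g, smooth_on I g -> is_derive (fun v => RInt g t0 v) t (g t)).
  { intros g Sg.
    apply (locally_singleton t (fun x => is_derive (fun v => RInt g t0 v) x (g x))).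
    now apply (locally_is_derive_RInt I). }
  split; [|split].
  - exact (H _ C1).
  - exact (H _ C2).
  - exact (H _ C3).
Qed.

(** * Moving frames *)

Lemma mdot_vderive_of_const (I : R -> Prop) (c d : R -> R31) (k t : R) :
  is_interval I -> vsmooth_on I c -> vsmooth_on I d -> I t ->
  (forall x, I x -> mdot (c x) (d x) = k) ->
  mdot (vderive c t) (d t) + mdot (c t) (vderive d t) = 0.
Proof.
  intros HI Sc Sd It E.
  apply (is_derive_unique_on I (fun x => mdot (c x) (d x)) (fun _ => k) t);
    try easy.
  - apply is_derive_mdot; now apply (vsmooth_is_vderive I).
  - apply (is_derive_const (K := R_AbsRing) (V := R_NormedModule)).
Qed.

(** Differentiating [<p, p> = 1], [<q, q> = 1] and [<p, q> = 0] gives the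
    components of [q'] along [p] and [q]; the one along [g] is free, and is
    [mu] up to sign. Then [g' = p x q'] reduces to [- mu p x g = - mu q].
    With [lam] the curvature this contains the Frenet equations, and with
    [lam = 1] the equations of a unit speed curve in de Sitter space. *)
Lemma moving_frame (I : R -> Prop) (p q : R -> R31) (lam : R -> R) :
  is_interval I -> vsmooth_on I p -> vsmooth_on I q ->
  (forall t, I t -> mdot (p t) (p t) = 1) ->
  (forall t, I t -> mdot (q t) (q t) = 1) ->
  (forall t, I t -> lam t <> 0) ->
  (forall t, I t -> vderive p t = scal (lam t) (q t)) ->
  let g := fun t => cross (p t) (q t) in
  let mu := fun t => mdot (vderive q t) (g t) in
  forall t, I t ->
    mdot (p t) (q t) = 0 /\
    mdot (vderive q t) (p t) = - lam t /\
    is_vderive g t (scal (- mu t) (q t)).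
Proof.
  intros HI Sp Sq pp qq lam0 Ep g mu.
  assert (pq : forall t, I t -> mdot (p t) (q t) = 0).
  { intros t It.
    pose proof (mdot_vderive_of_const I p p 1 t HI Sp Sp It pp) as H.
    rewrite (Ep t It), mdot_scal_l, mdot_scal_r, (mdot_comm (q t)) in H.
    pose proof (lam0 t It). nra. }
  intros t It.
  pose proof (mdot_vderive_of_const I q q 1 t HI Sq Sq It qq) as Hq.
  pose proof (mdot_vderive_of_const I p q 0 t HI Sp Sq It pq) as Hpq.
  rewrite (Ep t It), mdot_scal_l, (qq t It), (mdot_comm (p t)) in Hpq.
  rewrite (mdot_comm (q t)) in Hq.
  assert (Hp : mdot (vderive q t) (p t) = - lam t) by lra.
  split; [now apply pq|split; [exact Hp|]].
  eapply is_vderive_eq;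
    [apply is_vderive_cross; apply (vsmooth_is_vderive I); eassumption|].
  rewrite (Ep t It).
  pose proof (frame_expansion (p t) (q t) (vderive q t) (pp t It) (qq t It)
                (pq t It)) as E.
  rewrite Hp in E. replace (mdot (vderive q t) (q t)) with 0 in E by lra.
  fold (g t) in E. fold (mu t) in E.
  rewrite E. rewrite !cross_plus_r, !cross_scal_r.
  unfold g. rewrite cross_cross, (pp t It), (pq t It).
  generalize (p t) (q t) (mu t) (lam t). intros P Q m l. vec_ring.
Qed.

Lemma frenet_mdot_pos (J : R -> Prop) (alpha : R -> R31) (s : R) :
  frenet_assumption J alpha -> J s ->
  0 < mdot (vderive (tangent alpha) s) (vderive (tangent alpha) s).
Proof.
  intros F Js. destruct (F s Js) as [N [P|E]]; [exact P|contradiction].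
Qed.

Lemma vsmooth_on_normal (J : R -> Prop) (alpha : R -> R31) :
  vsmooth_on J alpha -> frenet_assumption J alpha ->
  vsmooth_on J (normal alpha).
Proof.
  intros Sa F.
  assert (S2 : vsmooth_on J (vderive (vderive alpha)))
    by now do 2 apply vsmooth_on_vderive.
  apply (vsmooth_on_scal J
    (fun s => rsqrt_abs (mdot (vderive (vderive alpha) s)
                              (vderive (vderive alpha) s)))); [|exact S2].
  apply smooth_on_rsqrt_abs; [now apply smooth_on_mdot|].
  intros s Js. now apply (frenet_mdot_pos J).
Qed.

(** * Hyperbolic tangent *)

Lemma tanh_exp (x : R) :
  tanh x = (exp x * exp x - 1) / (exp x * exp x + 1).
Proof.
  pose proof (exp_pos x).
  unfold tanh, sinh, cosh. rewrite exp_Ropp. field. nra.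
Qed.

Lemma tanh_sqr_lt_1 (x : R) : 0 < 1 - tanh x * tanh x.
Proof.
  rewrite tanh_exp. pose proof (exp_pos x) as P. remember (exp x) as e.
  replace (1 - (e * e - 1) / (e * e + 1) * ((e * e - 1) / (e * e + 1)))
    with ((4 * (e * e)) / ((e * e + 1) * (e * e + 1))) by (field; nra).
  apply Rdiv_lt_0_compat; nra.
Qed.

Lemma tanh_neq_0 (x : R) : x <> 0 -> tanh x <> 0.
Proof.
  intros Hx. rewrite tanh_exp, <- exp_plus.
  pose proof (exp_pos (x + x)).
  intros E. assert (E1 : exp (x + x) = exp 0).
  { rewrite exp_0. apply Rmult_eq_compat_r with (r := exp (x + x) + 1) in E.
    field_simplify in E; lra. }
  apply exp_inv in E1. lra.
Qed.

Lemma tanh_surjective (r : R) : Rabs r < 1 -> exists x, tanh x = r.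
Proof.
  intros Hr. apply Rabs_def2 in Hr.
  assert (P : 0 < (1 + r) / (1 - r)) by (apply Rdiv_lt_0_compat; lra).
  exists (ln ((1 + r) / (1 - r)) / 2).
  rewrite tanh_exp, <- exp_plus.
  replace (ln ((1 + r) / (1 - r)) / 2 + ln ((1 + r) / (1 - r)) / 2)
    with (ln ((1 + r) / (1 - r))) by field.
  rewrite exp_ln by exact P. field. lra.
Qed.

(** With [theta = 1], [xi1] takes every real value as [u] runs through the
    positive numbers; it vanishes at [u = 1], which [r <> 0] excludes. *)
Lemma tanh_xi1_surjective (r : R) : r <> 0 -> Rabs r < 1 ->
  exists theta u, theta <> 0 /\ 0 < u /\ u <> 1 /\ tanh (xi1 theta u) = r.
Proof.
  intros r0 Hr. destruct (tanh_surjective r Hr) as [x Hx].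
  assert (t1 : tanh 1 <> 0) by (apply tanh_neq_0; lra).
  assert (E : xi1 1 (exp (x / tanh 1)) = x).
  { unfold xi1. rewrite ln_exp. now field. }
  exists 1, (exp (x / tanh 1)). repeat split.
  - lra.
  - apply exp_pos.
  - intros E1. apply r0. rewrite <- Hx, <- E, E1. unfold xi1.
    rewrite ln_1, Rmult_0_r, tanh_exp, exp_0. field.
  - now rewrite E.
Qed.

Lemma tanh_xi1_neq_0 (theta u : R) :
  theta <> 0 -> 0 < u -> u <> 1 -> tanh (xi1 theta u) <> 0.
Proof.
  intros Ht Hu u1. apply tanh_neq_0. unfold xi1.
  apply Rmult_integral_contrapositive. split; [now apply tanh_neq_0|].
  now apply ln_neq_0.
Qed.

(** * The constructed curve *)

Lemma vsmooth_on_cross_vderive (I : R -> Prop) (f : R -> R31) :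
  vsmooth_on I f -> vsmooth_on I (fun t => cross (f t) (vderive f t)).
Proof.
  intros Sf. apply vsmooth_on_cross; [exact Sf|now apply vsmooth_on_vderive].
Qed.

Lemma is_vderive_gamma_tilde (a theta u : R) (I : R -> Prop) (f : R -> R31) (t : R) :
  is_interval I -> I 0 -> vsmooth_on I f -> I t ->
  is_vderive (gamma_tilde a theta u f) t
    (plus (scal a (f t))
          (scal (a * tanh (xi1 theta u)) (cross (f t) (vderive f t)))).
Proof.
  intros HI I0 Sf It.
  apply is_vderive_plus; apply is_vderive_scal.
  - now apply (is_vderive_vint I).
  - now apply (is_vderive_vint I (fun t => cross (f t) (vderive f t)));
      [..|apply vsmooth_on_cross_vderive].
Qed.

Lemma vsmooth_on_gamma_tilde (a theta u : R) (I : R -> Prop) (f : R -> R31) :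
  is_interval I -> I 0 -> vsmooth_on I f ->
  vsmooth_on I (gamma_tilde a theta u f).
Proof.
  intros HI I0 Sf.
  apply vsmooth_on_plus;
    (apply vsmooth_on_scal; [apply smooth_on_const|apply vsmooth_on_vint]);
    try easy.
  now apply vsmooth_on_cross_vderive.
Qed.

(** * Constructed curves are Bertrand curves *)

(** For a curve of constant speed [c] the change to arc length is affine, with
    inverse [h t = c (t - b)]. *)
Lemma arc_length_of_constant_speed (I : R -> Prop) (gamma : R -> R31) (b c : R) :
  is_interval I -> vsmooth_on I gamma -> 0 < c ->
  (forall t, I t -> mdot (vderive gamma t) (vderive gamma t) = c * c) ->
  let J := fun s => I (/ c * s + b) in
  let alpha := fun s => gamma (/ c * s + b) in
  is_interval J /\
  (forall s, J s -> tangent alpha s = scal (/ c) (vderive gamma (/ c * s + b))) /\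
  arc_length_param I gamma J alpha.
Proof.
  intros HI Sg cp Hc J alpha.
  set (h := fun t => c * t + - (c * b)).
  assert (Eh : forall t, / c * h t + b = t) by (intros t; unfold h; field; lra).
  assert (HJ : forall s, J s <-> exists t, I t /\ h t = s).
  { intros s. split.
    - intros Js. exists (/ c * s + b). split; [exact Js|unfold h; field; lra].
    - intros [t [It <-]]. unfold J. now rewrite Eh. }
  assert (Dh : forall t, is_derive h t c) by (intros t; unfold h; auto_derive; [easy|ring]).
  assert (Sh : smooth_on I h).
  { apply smooth_on_antiderivative with (fun _ => c); [apply smooth_on_const|].
    intros t _. now apply filter_forall. }
  assert (Dh0 : forall t, I t -> 0 < Derive h t).
  { intros t _. now rewrite (is_derive_unique h t c (Dh t)). }
  assert (Ta : forall s, J s ->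
    tangent alpha s = scal (/ c) (vderive gamma (/ c * s + b))).
  { intros s Js. apply is_vderive_unique, is_vderive_comp_affine.
    now apply (vsmooth_is_vderive I). }
  assert (TT : forall s, J s -> mdot (vderive alpha s) (vderive alpha s) = 1).
  { intros s Js. unfold tangent in Ta.
    rewrite (Ta s Js), mdot_scal_l, mdot_scal_r, Hc by exact Js. field. lra. }
  split; [|split; [exact Ta|]].
  - now apply (is_interval_image I J h).
  - split; [split|split].
    + now apply (vsmooth_on_comp_affine J I).
    + intros s Js. apply spacelike_of_mdot_pos. rewrite (TT s Js). lra.
    + intros s Js. now apply mnorm_of_mdot, TT.
    + exists h. do 3 (split; [easy|]).
      intros t _. unfold alpha. now rewrite Eh.
Qed.

(** The pseudo-norm only sees [m] up to sign. With the sign recorded as [e],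
    and [e] the same along an interval, the normal can be differentiated there
    as a constant multiple of [n]. *)
Lemma normal_of_tangent_derivative (alpha : R -> R31) (s m e : R) (n : R31) :
  e * e = 1 -> mdot n n = 1 -> vderive (tangent alpha) s = scal m n ->
  0 < e * m ->
  curvature alpha s = e * m /\ normal alpha s = scal e n.
Proof.
  intros ee nn H P.
  assert (K : curvature alpha s = e * m).
  { unfold curvature. rewrite H, mnorm_scal_unit by exact nn.
    rewrite <- (Rabs_right (e * m)) by lra.
    rewrite <- !sqrt_Rsqr_abs. f_equal. unfold Rsqr.
    transitivity (e * e * (m * m)); [rewrite ee|]; ring. }
  split; [exact K|].
  change (normal alpha s)
    with (scal (/ curvature alpha s) (vderive (tangent alpha) s)).
  rewrite K, H.
  assert (E : / (e * m) * m = e).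
  { assert (m <> 0) by nra. assert (e <> 0) by nra.
    transitivity (e * e * (/ (e * m) * m)); [rewrite ee; ring|now field]. }
  transitivity (scal (/ (e * m) * m) n); [vec_ring|now rewrite E].
Qed.

(** The coefficients of the Bertrand relation are [e a] and [a tanh xi1], with
    [e] the constant sign of the factor between the principal normal direction
    and [f']. *)
Lemma bertrand_of_construction (a theta u : R) (I : R -> Prop) (f : R -> R31) :
  construction_data a theta u I f ->
  (forall (J : R -> Prop) (alpha : R -> R31),
     arc_length_param I (gamma_tilde a theta u f) J alpha ->
     frenet_assumption J alpha) ->
  spacelike_bertrand I (gamma_tilde a theta u f).
Proof.
  intros [a0 [th0 [u0 [u1 [HI [I0 [[Sf Lf] [Uf Df]]]]]]]] HF.
  pose proof (tanh_xi1_neq_0 theta u th0 u0 u1) as r0.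
  pose proof (tanh_sqr_lt_1 (xi1 theta u)) as r1.
  pose proof (fun t => is_vderive_gamma_tilde a theta u I f t HI I0 Sf) as Dg.
  pose proof (vsmooth_on_gamma_tilde a theta u I f HI I0 Sf) as Sg.
  set (gam := gamma_tilde a theta u f) in *.
  set (r := tanh (xi1 theta u)) in *. clearbody gam r.
  assert (Sf' : vsmooth_on I (vderive f)) by now apply vsmooth_on_vderive.
  assert (qq : forall t, I t -> mdot (vderive f t) (vderive f t) = 1).
  { intros t It. apply mdot_of_mnorm; [now apply Lf|now apply Uf]. }
  assert (f'1 : forall t, I t -> vderive f t = scal 1 (vderive f t)).
  { intros t _. generalize (vderive f t). intros v. vec_ring. }
  pose proof (moving_frame I f (vderive f) (fun _ => 1) HI Sf Sf' Df qq
    (fun _ _ => R1_neq_R0) f'1) as M.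
  cbv zeta beta in M.
  set (g := fun t => cross (f t) (vderive f t)) in *.
  set (k := fun t => mdot (vderive (vderive f) t) (g t)) in *.
  assert (vv : forall t, I t ->
    mdot (vderive gam t) (vderive gam t) = a * a * (1 - r * r)).
  { intros t It. rewrite (is_vderive_unique _ _ _ (Dg t It)).
    rewrite mdot_tangent_binormal; [ring|..];
      [now apply Df|now apply qq|now apply M]. }
  assert (P : 0 < a * a * (1 - r * r)) by (apply Rmult_lt_0_compat; [nra|exact r1]).
  set (c := sqrt (a * a * (1 - r * r))).
  assert (cp : 0 < c) by now apply sqrt_lt_R0.
  assert (cc : c * c = a * a * (1 - r * r)) by (apply sqrt_sqrt; lra).
  clearbody c.
  destruct (arc_length_of_constant_speed I gam 0 c HI Sg cp) as [IJ [Ta Ha]].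
  { intros t It. now rewrite cc, vv. }
  set (J := fun s => I (/ c * s + 0)) in *.
  set (alpha := fun s => gam (/ c * s + 0)) in *.
  assert (Sa : vsmooth_on J alpha) by apply Ha.
  assert (F : frenet_assumption J alpha) by now apply HF.
  assert (T' : forall s, J s -> vderive (tangent alpha) s
    = scal (/ c * / c * (a * (1 - r * k (/ c * s + 0)))) (vderive f (/ c * s + 0))).
  { intros s Js.
    apply (vderive_eq_on J _
      (fun s => scal (/ c) (plus (scal a (f (/ c * s + 0)))
                                 (scal (a * r) (g (/ c * s + 0))))) s);
      try easy; [now apply vsmooth_on_vderive| |].
    - intros x Jx. rewrite (Ta x Jx). f_equal. now apply is_vderive_unique, Dg.
    - eapply is_vderive_eq.
      + apply (is_vderive_comp_affine (/ c) 0
          (fun t => scal (/ c) (plus (scal a (f t)) (scal (a * r) (g t))))).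
        apply is_vderive_scal, is_vderive_plus; apply is_vderive_scal.
        * now apply (vsmooth_is_vderive I).
        * now apply M.
      + fold (g (/ c * s + 0)) (k (/ c * s + 0)).
        generalize (vderive f (/ c * s + 0)) (k (/ c * s + 0)).
        intros v w. vec_ring. }
  (* The Frenet assumption rules out a vanishing derivative of the tangent. *)
  assert (N0 : forall t, I t -> a * (1 - r * k t) <> 0).
  { intros t It E.
    assert (Et : / c * (c * t) + 0 = t) by (field; lra).
    assert (Js : J (c * t)) by (unfold J; now rewrite Et).
    destruct (F (c * t) Js) as [N _]. apply N.
    rewrite (T' _ Js), Et, E. generalize (vderive f t). intros v. vec_ring. }
  destruct (constant_sign_on I (fun t => a * (1 - r * k t)) HI)
    as [e [He Pe]]; [|exact N0|].
  { intros t It. apply (smooth_on_continuity_pt I); [|exact It].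
    apply smooth_on_mult; [apply smooth_on_const|].
    apply smooth_on_minus; [apply smooth_on_const|].
    apply smooth_on_mult; [apply smooth_on_const|].
    apply smooth_on_mdot; [now apply vsmooth_on_vderive|].
    now apply vsmooth_on_cross_vderive. }
  assert (ee : e * e = 1) by (destruct He as [-> | ->]; ring).
  assert (KN : forall s, J s ->
    curvature alpha s = e * (/ c * / c * (a * (1 - r * k (/ c * s + 0)))) /\
    normal alpha s = scal e (vderive f (/ c * s + 0))).
  { intros s Js. apply normal_of_tangent_derivative; auto.
    pose proof (Pe _ Js). pose proof (Rinv_0_lt_compat c cp).
    replace (e * (/ c * / c * (a * (1 - r * k (/ c * s + 0)))))
      with (/ c * / c * (e * (a * (1 - r * k (/ c * s + 0))))) by ring.
    apply Rmult_lt_0_compat; [now apply Rmult_lt_0_compat|easy]. }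
  assert (To : forall s, J s ->
    torsion alpha s = / c * / c * a * (k (/ c * s + 0) - r)).
  { intros s Js.
    assert (N' : vderive (normal alpha) s
      = scal (/ c) (scal e (vderive (vderive f) (/ c * s + 0)))).
    { apply (vderive_eq_on J _ (fun s => scal e (vderive f (/ c * s + 0))) s);
        try easy; [now apply vsmooth_on_normal|now apply KN|].
      apply (is_vderive_comp_affine (/ c) 0 (fun t => scal e (vderive f t))).
      apply is_vderive_scal. now apply (vsmooth_is_vderive I). }
    unfold torsion, binormal.
    rewrite N', (proj2 (KN s Js)), (Ta s Js), (is_vderive_unique _ _ _ (Dg _ Js)).
    destruct (M _ Js) as [pq [qp _]].
    rewrite !cross_scal_l, !cross_scal_r, !mdot_scal_l, !mdot_scal_r,
      mdot_cross_tangent_binormal, qp by (exact pq || now apply qq).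
    fold (g (/ c * s + 0)). fold (k (/ c * s + 0)).
    transitivity (e * e * (/ c * / c * a * (k (/ c * s + 0) - r))); [ring|].
    rewrite ee. ring. }
  exists (e * a), (a * r). split; [|split].
  - destruct He as [-> | ->]; lra.
  - now apply Rmult_integral_contrapositive.
  - split; [split; [exact Sg|]|].
    + intros t It. apply spacelike_of_mdot_pos. now rewrite vv.
    + exists J, alpha. split; [exact Ha|split; [exact F|]].
      intros s Js. rewrite (proj1 (KN s Js)), (To s Js).
      transitivity (/ c * / c * (e * e * (a * a) * (1 - r * k (/ c * s + 0))
        + a * a * r * (k (/ c * s + 0) - r))); [ring|].
      rewrite ee. transitivity (/ c * / c * (a * a * (1 - r * r))); [ring|].
      rewrite <- cc. field. lra.
Qed.

(** * Bertrand curves are constructed curves *)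

(** The frame is taken with [cross T N], which is minus the binormal, so that
    [moving_frame] applies as it stands; its [mu] is the torsion. *)
Lemma frenet_frame (J : R -> Prop) (alpha : R -> R31) :
  is_interval J -> spacelike_curve J alpha -> unit_speed J alpha ->
  frenet_assumption J alpha ->
  forall s, J s ->
    mdot (tangent alpha s) (tangent alpha s) = 1 /\
    mdot (normal alpha s) (normal alpha s) = 1 /\
    mdot (tangent alpha s) (normal alpha s) = 0 /\
    is_vderive (tangent alpha) s (scal (curvature alpha s) (normal alpha s)) /\
    is_vderive (fun s => cross (tangent alpha s) (normal alpha s)) s
      (scal (- torsion alpha s) (normal alpha s)).
Proof.
  intros HJ [Sa La] Ua F.
  assert (St : vsmooth_on J (tangent alpha)) by now apply vsmooth_on_vderive.
  assert (Sn : vsmooth_on J (normal alpha)) by now apply vsmooth_on_normal.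
  assert (TT : forall s, J s -> mdot (tangent alpha s) (tangent alpha s) = 1).
  { intros s Js. apply mdot_of_mnorm; [now apply La|now apply Ua]. }
  assert (K : forall s, J s -> 0 < curvature alpha s /\
     curvature alpha s * curvature alpha s
     = mdot (vderive (tangent alpha) s) (vderive (tangent alpha) s)).
  { intros s Js. pose proof (frenet_mdot_pos J alpha s F Js) as P.
    unfold curvature, mnorm. rewrite Rabs_right by lra.
    split; [now apply sqrt_lt_R0|apply sqrt_sqrt; lra]. }
  assert (NN : forall s, J s -> mdot (normal alpha s) (normal alpha s) = 1).
  { intros s Js. destruct (K s Js) as [K0 K1].
    change (normal alpha s)
      with (scal (/ curvature alpha s) (vderive (tangent alpha) s)).
    rewrite mdot_scal_l, mdot_scal_r, <- K1. field. lra. }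
  assert (T' : forall s, J s ->
    vderive (tangent alpha) s = scal (curvature alpha s) (normal alpha s)).
  { intros s Js. destruct (K s Js) as [K0 _].
    change (normal alpha s)
      with (scal (/ curvature alpha s) (vderive (tangent alpha) s)).
    generalize dependent (curvature alpha s). intros k k0.
    generalize (vderive (tangent alpha) s). intros v.
    transitivity (scal (k * / k) v); [|vec_ring].
    rewrite Rinv_r by lra. vec_ring. }
  intros s Js.
  destruct (moving_frame J (tangent alpha) (normal alpha) (curvature alpha) HJ
    St Sn TT NN (fun s Js => Rgt_not_eq _ _ (proj1 (K s Js))) T' s Js)
    as [TN [_ G']].
  split; [now apply TT|]. split; [now apply NN|]. split; [exact TN|]. split.
  - rewrite <- T' by exact Js. now apply (vsmooth_is_vderive J).
  - eapply is_vderive_eq; [exact G'|]. f_equal. unfold torsion, binormal.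
    rewrite (cross_anticomm (normal alpha s)), mdot_scal_r. ring.
Qed.

(** The curve in de Sitter space is [(A T + B b) / c] with [b] the binormal,
    in the parameter [(s - s0) / c], where [s] is arc length. The shift by
    [s0], a value of arc length on the curve, is there because the integrals of
    the construction start at 0, which must belong to the parameter
    interval. *)
Lemma construction_of_bertrand (I : R -> Prop) (gamma : R -> R31) (A B : R) :
  is_interval I -> B <> 0 -> bertrand_with A B I gamma -> Rabs B < Rabs A ->
  constructed I gamma.
Proof.
  intros HI B0 [_ [J [alpha [[La [Ua [h [Sh [Dh [HJ Eh]]]]]] [F AB]]]]] BA.
  assert (A0 : A <> 0).
  { intros ->. rewrite Rabs_R0 in BA. pose proof (Rabs_pos B). lra. }
  assert (IJ : is_interval J) by now apply (is_interval_image I J h).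
  pose proof (frenet_frame J alpha IJ La Ua F) as Fr.
  assert (Sa : vsmooth_on J alpha) by apply La.
  assert (St : vsmooth_on J (tangent alpha)) by now apply vsmooth_on_vderive.
  assert (Sn : vsmooth_on J (normal alpha)) by now apply vsmooth_on_normal.
  set (T := tangent alpha) in *. set (N := normal alpha) in *.
  set (G := fun s => cross (T s) (N s)) in *.
  set (ka := curvature alpha) in *. set (ta := torsion alpha) in *.
  assert (P : 0 < A * A - B * B).
  { apply Rsqr_lt_abs_1 in BA. unfold Rsqr in BA. lra. }
  set (c := sqrt (A * A - B * B)).
  assert (cp : 0 < c) by now apply sqrt_lt_R0.
  assert (cc : c * c = A * A - B * B) by (apply sqrt_sqrt; lra).
  clearbody c.
  destruct (tanh_xi1_surjective (B / A)) as [theta [u [th0 [u0 [u1 Er]]]]].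
  { unfold Rdiv. apply Rmult_integral_contrapositive. split; [exact B0|].
    now apply Rinv_neq_0_compat. }
  { rewrite Rabs_div by exact A0. apply Rmult_lt_reg_r with (Rabs A).
    - now apply Rabs_pos_lt.
    - unfold Rdiv. rewrite Rmult_assoc, Rinv_l, Rmult_1_r, Rmult_1_l; [exact BA|].
      now apply Rabs_no_R0. }
  destruct HI as [HI0 [t0 [t1 [It0 [It1 t01]]]]].
  assert (HI : is_interval I) by (split; [exact HI0|now exists t0, t1]).
  set (s0 := h t0).
  set (phi := fun t => / c * h t + - s0 / c).
  set (J' := fun v => J (c * v + s0)).
  set (f := fun v => scal (/ c)
    (plus (scal A (T (c * v + s0))) (scal (- B) (G (c * v + s0))))).
  assert (Ephi : forall t, c * phi t + s0 = h t).
  { intros t. unfold phi. field. lra. }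
  assert (HJ' : forall v, J' v <-> exists t, I t /\ phi t = v).
  { intros v. split.
    - intros Jv. apply HJ in Jv. destruct Jv as [t [It Et]]. exists t.
      split; [exact It|]. unfold phi. rewrite Et. field. lra.
    - intros [t [It <-]]. unfold J'. rewrite Ephi. apply HJ. now exists t. }
  assert (Sphi : smooth_on I phi).
  { apply smooth_on_plus; [|apply smooth_on_const].
    apply smooth_on_mult; [apply smooth_on_const|exact Sh]. }
  assert (Dphi : forall t, I t -> 0 < Derive phi t).
  { intros t It. replace (Derive phi t) with (/ c * Derive h t).
    - apply Rmult_lt_0_compat; [now apply Rinv_0_lt_compat|now apply Dh].
    - symmetry. apply is_derive_unique. evar_last.
      + apply is_derive_Rplus.
        * apply is_derive_scal. now apply (smooth_on_is_derive I).
        * apply (is_derive_const (K := R_AbsRing) (V := R_NormedModule)).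
      + unfold zero; simpl. ring. }
  assert (IJ' : is_interval J') by now apply (is_interval_image I J' phi).
  assert (J'0 : J' 0).
  { apply HJ'. exists t0. split; [exact It0|]. unfold phi, s0. field. lra. }
  assert (SG : vsmooth_on J G) by now apply vsmooth_on_cross.
  assert (Sf : vsmooth_on J' f).
  { apply (vsmooth_on_comp_affine J' J
      (fun s => scal (/ c) (plus (scal A (T s)) (scal (- B) (G s)))) c s0);
      [|easy].
    apply vsmooth_on_scal; [apply smooth_on_const|].
    apply vsmooth_on_plus; (apply vsmooth_on_scal; [apply smooth_on_const|easy]). }
  (* This is where the Bertrand relation enters. *)
  assert (f' : forall v, J' v -> vderive f v = N (c * v + s0)).
  { intros v Jv. destruct (Fr _ Jv) as [_ [_ [_ [T' G']]]].
    apply is_vderive_unique. eapply is_vderive_eq.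
    - apply (is_vderive_comp_affine c s0
        (fun s => scal (/ c) (plus (scal A (T s)) (scal (- B) (G s))))).
      apply is_vderive_scal, is_vderive_plus; apply is_vderive_scal;
        [exact T'|exact G'].
    - pose proof (AB _ Jv) as E. fold ka ta in E |- *.
      generalize dependent (N (c * v + s0)). intros n _ _.
      transitivity (scal (c * / c * (A * ka (c * v + s0) + B * ta (c * v + s0))) n);
        [vec_ring|].
      rewrite E, Rinv_r by lra. vec_ring. }
  assert (ff : forall v, J' v -> mdot (f v) (f v) = 1).
  { intros v Jv. destruct (Fr _ Jv) as [TT [NN [TN _]]].
    unfold f, G.
    rewrite mdot_scal_l, mdot_scal_r, mdot_tangent_binormal by assumption.
    transitivity (/ c * / c * (A * A - B * B)); [ring|].
    rewrite <- cc. field. lra. }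
  assert (ff' : forall v, J' v -> mdot (vderive f v) (vderive f v) = 1).
  { intros v Jv. rewrite (f' v Jv). now apply Fr. }
  exists A, theta, u, J', f, phi, (alpha s0).
  split; [|split; [exact Sphi|split; [exact Dphi|split; [exact HJ'|]]]].
  { do 6 (split; [easy|]). split; [|split].
    - split; [exact Sf|]. intros v Jv. apply spacelike_of_mdot_pos.
      rewrite (ff' v Jv). lra.
    - intros v Jv. now apply mnorm_of_mdot, ff'.
    - exact ff. }
  intros t It. rewrite (Eh t It), <- Ephi.
  (* Both sides agree at 0 and have velocity [c T]. *)
  apply (eq_on_of_is_vderive J' (fun v => alpha (c * v + s0))
    (fun v => plus (alpha s0) (gamma_tilde A theta u f v))
    (fun v => scal c (T (c * v + s0))) 0); [exact IJ'|exact J'0|..].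
  - cbv beta. rewrite Rmult_0_r, Rplus_0_l.
    unfold gamma_tilde, vint. rewrite !RInt_point.
    generalize (alpha s0). intros p. vec_ring.
  - intros v Jv. apply (is_vderive_comp_affine c s0).
    now apply (vsmooth_is_vderive J).
  - intros v Jv. eapply is_vderive_eq.
    + apply is_vderive_plus; [apply is_vderive_const|].
      now apply (is_vderive_gamma_tilde A theta u J').
    + rewrite Er, (f' v Jv). destruct (Fr _ Jv) as [TT [NN [TN _]]].
      unfold f, G.
      generalize dependent (T (c * v + s0)). intros p TT TN.
      generalize dependent (N (c * v + s0)). intros q NN TN.
      rewrite cross_scal_l, cross_tangent_binormal by assumption.
      generalize (cross p q). intros w.
      transitivity (scal (/ c * (A * A - B * B)) p); [|rewrite <- cc; f_equal; field; lra].
      apply R31_ext; vec_coords; field; lra.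
  - apply HJ'. now exists t.
Qed.

(* The restriction |B| < |A| in the second part is necessary: the constructed
   curves satisfy the Bertrand relation with |A| = |a| and |B| = |a tanh xi1|,
   and A, B are unique when the curvature is not constant. *)
Theorem lemma1 :
  (forall (a theta u : R) (I : R -> Prop) (f : R -> R31),
     construction_data a theta u I f ->
     (forall (J : R -> Prop) (alpha : R -> R31),
        arc_length_param I (gamma_tilde a theta u f) J alpha ->
        frenet_assumption J alpha) ->
     spacelike_bertrand I (gamma_tilde a theta u f)) /\
  (forall (I : R -> Prop) (gamma : R -> R31) (A B : R),
     is_interval I ->
     A <> 0 -> B <> 0 ->
     bertrand_with A B I gamma ->
     Rabs B < Rabs A ->
     constructed I gamma).
Proof.
  split.
  - exact bertrand_of_construction.
  - intros I gamma A B HI _ B0. now apply construction_of_bertrand.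
Qed.
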